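(* Let $R$ be a Bézout domain and let $W\in R$ be a critically-finite element. Then the additive category $\mathbf{hef}(R,W)$ is Krull-Schmidt, and its non-zero indecomposable objects are, up to isomorphism, the non-trivial primary matrix factorizations of $W$ (i.e. those primary matrix factorizations which are not zero objects). In particular, $\mathbf{hef}(R,W)$ is additively generated by $\mathrm{hef}_0(R,W)$.
   Context: All rings are unital and commutative. A Bézout domain is an integral domain in which every finitely generated ideal is principal; greatest common divisors exist in it. Critically-finite elements: for $W\in R\setminus\{0\}$, a critical divisor of $W$ is a non-unit $d\in R$ with $d^2\mid W$. A non-zero non-unit $W\in R$ is critically-finite if $W=W_0W_c$ with $W_c=p_1^{n_1}\cdots p_N^{n_N}$, where $n_j\ge 2$, the $p_j$ are prime elements of $R$ which are pairwise non-associated, and $W_0\in R\setminus\{0\}$ has no critical divisors and is coprime with $W_c$. Matrix factorizations: for $W\in R\setminus\{0\}$, a (finite rank) matrix factorization of $W$ is a pair $a=(M,D)$ with $M=M^{\hat 0}\oplus M^{\hat 1}$ a free $\mathbb{Z}_2$-graded $R$-module of finite rank and $D$ an odd endomorphism of $M$ with $D^2=W\,\mathrm{id}_M$. For $a_i=(M_i,D_i)$, the $\mathbb{Z}_2$-graded module $\mathrm{Hom}_R(M_1,M_2)$ carries the differential $\mathfrak{d}(f)=D_2\circ f-(-1)^{\kappa}f\circ D_1$ for $f$ of degree $\kappa$. The category $\mathrm{HMF}(R,W)$ has these objects, with morphisms the total cohomology of this differential; $\mathrm{hmf}(R,W)$ is the subcategory with the same objects and only the even (degree $\hat 0$) cohomology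 classes as morphisms. It is additive under direct sum of matrix factorizations. Elementary factorizations: a matrix factorization is elementary if $M^{\hat 0}$ and $M^{\hat 1}$ have rank one. For a divisor $v$ of $W$ with $u=W/v$, $e_v=(R^{1|1},D_v)$ with $R^{1|1}=R\oplus R$ (even part first) and $D_v=\begin{pmatrix}0&v\\ u&0\end{pmatrix}$. The category $\mathrm{hef}(R,W)$ is the full subcategory of $\mathrm{hmf}(R,W)$ on elementary factorizations, and $\mathbf{hef}(R,W)$ is the smallest full subcategory of $\mathrm{hmf}(R,W)$ which contains all elementary factorizations of $W$ and is closed under finite direct sums. Primary factorizations: an element of $R$ is primary if it is a power of a prime element; $e_v$ is a primary matrix factorization of $W$ if $v$ is a primary divisor of $W$. $\mathrm{hef}_0(R,W)$ is the full subcategory of $\mathrm{hef}(R,W)$ on primary factorizations. ''Additively generated by $\mathrm{hef}_0(R,W)$'' means that every object is isomorphic to a finite direct sum of objects of $\mathrm{hef}_0(R,W)$. A Krull-Schmidt category is an additive category in which every object decomposes as a finite direct sum of objects having quasi-local endomorphism rings (a quasi-local ring is a ring with a unique maximal ideal, not necessarily Noetherian). *)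

(* Defs.v *)
From HB Require Import structures.
From mathcomp Require Import all_boot all_algebra.
From mathcomp Require Import boolp.

Set Implicit Arguments.
Unset Strict Implicit.
Unset Printing Implicit Defensive.

Import GRing.Theory.
Local Open Scope ring_scope.
Local Open Scope quotient_scope.

Definition rdvd (R : idomainType) (d x : R) : Prop := exists c, x = c * d.

Definition bezout_domain (R : idomainType) : Prop :=
  forall (n : nat) (a : 'I_n -> R), exists d : R, forall x : R,
    (exists c : 'I_n -> R, x = \sum_i c i * a i) <-> rdvd d x.

Definition prime_elt (R : idomainType) (p : R) : Prop :=
  [/\ p != 0, p \isn't a GRing.unit &
      forall x y, rdvd p (x * y) -> rdvd p x \/ rdvd p y].

Definition associated (R : idomainType) (x y : R) : Prop :=
  exists2 c, c \is a GRing.unit & y = c * x.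

Definition rcoprime (R : idomainType) (x y : R) : Prop :=
  forall d, rdvd d x -> rdvd d y -> d \is a GRing.unit.

(* Proper prime powers only: p ^+ 0 = 1 is not counted as primary. *)
Definition primary_elt (R : idomainType) (v : R) : Prop :=
  exists p n, [/\ prime_elt p, (0 < n)%N & v = p ^+ n].

Definition critical_divisor (R : idomainType) (W d : R) : Prop :=
  d \isn't a GRing.unit /\ rdvd (d ^+ 2) W.

Definition critically_finite (R : idomainType) (W : R) : Prop :=
  [/\ W != 0, W \isn't a GRing.unit &
   exists (W0 : R) (N : nat) (p : 'I_N -> R) (n : 'I_N -> nat),
   let Wc := \prod_i p i ^+ n i in
   [/\ W = W0 * Wc,
       forall i, prime_elt (p i) /\ (2 <= n i)%N,
       forall i j, i != j -> ~ associated (p i) (p j),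
       W0 != 0 /\ (forall d, ~ critical_divisor W0 d) &
       rcoprime W0 Wc]].

Definition left_ideal (E : pzRingType) (I : E -> Prop) : Prop :=
  [/\ I 0, forall x y, I x -> I y -> I (x + y) &
      forall a x, I x -> I (a * x)].

Definition maximal_left_ideal (E : pzRingType) (I : E -> Prop) : Prop :=
  [/\ left_ideal I, ~ I 1 &
      forall J : E -> Prop, left_ideal J -> ~ J 1 ->
        (forall x, I x -> J x) -> forall x, J x -> I x].

(* Endomorphism rings need not be commutative; for them, "local" refers to
   one-sided ideals. For commutative rings left ideals are just ideals. *)
Definition quasi_local (E : pzRingType) : Prop :=
  exists I : E -> Prop, maximal_left_ideal I /\
    forall J, maximal_left_ideal J -> forall x, I x <-> J x.

Record preadditive := Preadditive {
  obj :> Type;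
  mor : obj -> obj -> zmodType;
  idm : forall X, mor X X;
  comp : forall X Y Z, mor Y Z -> mor X Y -> mor X Z;
  compA : forall X Y Z T (h : mor Z T) (g : mor Y Z) (f : mor X Y),
    comp h (comp g f) = comp (comp h g) f;
  comp1m : forall X Y (f : mor X Y), comp (idm Y) f = f;
  compm1 : forall X Y (f : mor X Y), comp f (idm X) = f;
  compDl : forall X Y Z (g g' : mor Y Z) (f : mor X Y),
    comp (g + g') f = comp g f + comp g' f;
  compDr : forall X Y Z (g : mor Y Z) (f f' : mor X Y),
    comp g (f + f') = comp g f + comp g f'
}.
Arguments idm {p} X.
Arguments comp {p X Y Z} _ _.
Infix "\oc" := comp (at level 40, left associativity) : ring_scope.

Definition endo (C : preadditive) (X : C) : Type := mor X X.

HB.instance Definition _ (C : preadditive) (X : C) :=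
  GRing.Zmodule.on (endo X).
HB.instance Definition _ (C : preadditive) (X : C) :=
  GRing.Zmodule_isPzRing.Build (endo X) (@compA C X X X X)
    (@comp1m C X X) (@compm1 C X X)
    (fun g g' f => @compDl C X X X g g' f) (@compDr C X X X).

Definition isomorphic (C : preadditive) (X Y : C) : Prop :=
  exists (f : mor X Y) (g : mor Y X), g \oc f = idm X /\ f \oc g = idm Y.

Definition zero_object (C : preadditive) (X : C) : Prop :=
  forall Y : C, (forall f g : mor X Y, f = g) /\ (forall f g : mor Y X, f = g).

(* X is isomorphic to the direct sum (biproduct) of the finite family F; for
   the empty family this says that X is a zero object. *)
Definition direct_sum (C : preadditive) (I : finType) (F : I -> C) (X : C) :
    Prop :=
  exists (inj : forall i, mor (F i) X) (prj : forall i, mor X (F i)),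
    [/\ forall i, prj i \oc inj i = idm (F i),
        forall i j, i != j -> prj i \oc inj j = 0 &
        \sum_i inj i \oc prj i = idm X].

Definition additive_category (C : preadditive) : Prop :=
  forall (n : nat) (F : 'I_n -> C), exists X : C, direct_sum F X.

(* Being non-zero is required separately. *)
Definition indecomposable (C : preadditive) (X : C) : Prop :=
  forall F : bool -> C, direct_sum F X -> exists b, zero_object (F b).

Definition additively_generated (C : preadditive) (P : C -> Prop) : Prop :=
  forall X : C, exists (n : nat) (F : 'I_n -> C),
    (forall i, P (F i)) /\ direct_sum F X.

Definition krull_schmidt (C : preadditive) : Prop :=
  additive_category C /\
  additively_generated (fun X : C => quasi_local (endo X)).

Definition full_subcategory (C : preadditive) (P : C -> Prop) : preadditive :=
  @Preadditive {X : C | P X} (fun X Y => mor (sval X) (sval Y))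
    (fun X => idm (sval X)) (fun X Y Z => @comp C (sval X) (sval Y) (sval Z))
    (fun X Y Z T => @compA C (sval X) (sval Y) (sval Z) (sval T))
    (fun X Y => @comp1m C (sval X) (sval Y))
    (fun X Y => @compm1 C (sval X) (sval Y))
    (fun X Y Z => @compDl C (sval X) (sval Y) (sval Z))
    (fun X Y Z => @compDr C (sval X) (sval Y) (sval Z)).

(* A vectType over R is a free R-module of finite rank, and the module
   M0 (+) M1 is the product M0 * M1. Degrees are booleans:
   false is even, true is odd. *)
Definition in_degree (R : idomainType) (M0 M1 : vectType R) (i : bool)
    (x : M0 * M1) : Prop :=
  if i then x.1 = 0 else x.2 = 0.

Definition homogeneous (R : idomainType) (M0 M1 N0 N1 : vectType R) (k : bool)
    (f : 'Hom((M0 * M1)%type, (N0 * N1)%type)) : Prop :=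
  forall i x, in_degree i x -> in_degree (i (+) k) (f x).

Record matrix_factorization (R : idomainType) (W : R) := MatrixFactorization {
  mf_even : vectType R;
  mf_odd : vectType R;
  mf_D : 'End((mf_even * mf_odd)%type);
  mf_D_odd : homogeneous true mf_D;
  mf_D_sq : (mf_D \o mf_D)%VF = W *: \1%VF
}.

Notation mf_mod a := (mf_even a * mf_odd a)%type.

Section HMF.
Variables (R : idomainType) (W : R).
Implicit Types a b c : matrix_factorization W.

(* The value on f of the differential of Hom(a, b), for f of degree k. *)
Definition mf_diff a b (k : bool) (f : 'Hom(mf_mod a, mf_mod b)) :
    'Hom(mf_mod a, mf_mod b) :=
  (mf_D b \o f)%VF - (-1) ^+ k *: (f \o mf_D a)%VF.

Definition even_cocycle a b : {pred 'Hom(mf_mod a, mf_mod b)} :=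
  fun f => `[< homogeneous false f /\ mf_diff false f = 0 >].

Fact even_cocycle_zmod_closed a b : zmod_closed (@even_cocycle a b).
Proof.
split=> [|f g /asboolP [hf df] /asboolP [hg dg]]; apply/asboolP.
  split=> [i x _|]; last by rewrite /mf_diff comp_lfun0r comp_lfun0l scaler0 subr0.
  by rewrite lfunE /in_degree /=; case: (_ (+) _).
split=> [i x hx|].
  have := hf i x hx; have := hg i x hx; rewrite !lfun_simp /in_degree /=.
  by case: (_ (+) _) => -> ->; rewrite subr0.
rewrite -[RHS]subr0 -{1}df -dg /mf_diff !expr0 !scale1r.
by rewrite comp_lfunDl comp_lfunDr comp_lfunNl comp_lfunNr !opprD !opprK addrACA.
Qed.
HB.instance Definition _ a b := GRing.isZmodClosed.Build
  'Hom(mf_mod a, mf_mod b) (@even_cocycle a b) (@even_cocycle_zmod_closed a b).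

Record cocycle a b :=
  Cocycle { cocycle_val : 'Hom(mf_mod a, mf_mod b);
            cocycleP : cocycle_val \in @even_cocycle a b }.
HB.instance Definition _ a b := [isSub for @cocycle_val a b].
HB.instance Definition _ a b := [Choice of cocycle a b by <:].
HB.instance Definition _ a b :=
  [SubChoice_isSubZmodule of cocycle a b by <:].

Definition coboundary a b : {pred cocycle a b} :=
  fun f => `[< exists2 h : 'Hom(mf_mod a, mf_mod b),
                 homogeneous true h & val f = mf_diff true h >].

Fact coboundary_zmod_closed a b : zmod_closed (@coboundary a b).
Proof.
split=> [|f g /asboolP [h hh fE] /asboolP [k hk gE]]; apply/asboolP.
  exists 0; last by rewrite /mf_diff comp_lfun0r comp_lfun0l scaler0 subr0.
  by move=> i x _; rewrite lfunE /in_degree /=; case: (_ (+) _).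
exists (h - k).
  move=> i x hx; have := hh i x hx; have := hk i x hx.
  rewrite !lfun_simp /in_degree /=.
  by case: (_ (+) _) => -> ->; rewrite subr0.
rewrite raddfB /= fE gE /mf_diff !expr1 !scaleN1r !opprK.
by rewrite comp_lfunDl comp_lfunDr comp_lfunNl comp_lfunNr opprD addrACA.
Qed.
HB.instance Definition _ a b := GRing.isZmodClosed.Build
  (cocycle a b) (@coboundary a b) (@coboundary_zmod_closed a b).

Definition even_cohomology a b : zmodType := Quotient.quot (@coboundary a b).

Definition mf_class a b (f : cocycle a b) : even_cohomology a b :=
  \pi_(Quotient.quot (@coboundary a b)) f.

Fact mf_id_subproof a : (\1%VF : 'End(mf_mod a)) \in @even_cocycle a a.
Proof.
apply/asboolP; split=> [i x|]; first by rewrite id_lfunE addbF.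
by rewrite /mf_diff comp_lfun1r comp_lfun1l expr0 scale1r subrr.
Qed.
Definition cocycle_id a : cocycle a a := Cocycle (mf_id_subproof a).

Fact mf_comp_subproof a b c (g : cocycle b c) (f : cocycle a b) :
  (val g \o val f)%VF \in @even_cocycle a c.
Proof.
case: g f => g /asboolP [hg dg] [f /asboolP [hf df]] /=; apply/asboolP; split.
  by move=> i x /hf /hg; rewrite comp_lfunE !addbF.
move: df dg; rewrite /mf_diff !expr0 !scale1r => /subr0_eq df /subr0_eq dg.
by rewrite comp_lfunA dg -!comp_lfunA df subrr.
Qed.
Definition cocycle_comp a b c (g : cocycle b c) (f : cocycle a b) :
  cocycle a c := Cocycle (mf_comp_subproof g f).

Definition hmf_comp a b c (g : even_cohomology b c) (f : even_cohomology a b) :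
    even_cohomology a c :=
  mf_class (cocycle_comp (repr g) (repr f)).

Lemma mf_classP a b (f g : cocycle a b) :
  reflect (mf_class f = mf_class g) (f - g \in @coboundary a b).
Proof. by rewrite Quotient.idealrBE; apply: eqP. Qed.

Lemma mf_classD a b : {morph @mf_class a b : f g / f + g}.
Proof. by move=> f g; rewrite /mf_class !piE. Qed.

Lemma mf_class_reprK a b (f : even_cohomology a b) : mf_class (repr f) = f.
Proof. exact: reprK. Qed.

Lemma mf_class_surj a b (f : even_cohomology a b) : exists g, f = mf_class g.
Proof. by exists (repr f); rewrite mf_class_reprK. Qed.

Lemma hmf_compE a b c (g : cocycle b c) (f : cocycle a b) :
  hmf_comp (mf_class g) (mf_class f) = mf_class (cocycle_comp g f).
Proof.
rewrite /hmf_comp; set g' := repr _; set f' := repr _.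
have /mf_classP/asboolP [h hh /= hE] : mf_class g' = mf_class g.
  exact: mf_class_reprK.
have /mf_classP/asboolP [k hk /= kE] : mf_class f' = mf_class f.
  exact: mf_class_reprK.
apply/mf_classP/asboolP.
exists ((h \o val f') + (val g \o k))%VF.
  move=> i x hx; rewrite add_lfunE !comp_lfunE /in_degree /=.
  case: f' {kE} => f' /= /asboolP [hf' _]; case: g {g' hE} => g /= /asboolP [hg _].
  have := hh _ _ (hf' _ _ hx); have := hg _ _ (hk _ _ hx).
  rewrite !addbF /in_degree.
  by case: (_ (+) _) => /= -> ->; rewrite addr0.
have /asboolP [_] := cocycleP f'; have /asboolP [_] := cocycleP g.
rewrite /mf_diff !expr0 !scale1r => /subr0_eq dg /subr0_eq df.
move: hE kE; rewrite !raddfB /= /mf_diff !expr1 !scaleN1r !opprK => hE kE.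
have -> : (mf_D c \o ((h \o cocycle_val f') + (cocycle_val g \o k)))%VF +
   (((h \o cocycle_val f') + (cocycle_val g \o k)) \o mf_D a)%VF =
   (((mf_D c \o h) + (h \o mf_D b)) \o cocycle_val f')%VF +
   (cocycle_val g \o ((mf_D b \o k) + (k \o mf_D a)))%VF.
  rewrite !comp_lfunDl !comp_lfunDr !comp_lfunA dg.
  by rewrite -(comp_lfunA h) -df !comp_lfunA addrACA.
rewrite -hE -kE comp_lfunDl comp_lfunDr comp_lfunNl comp_lfunNr.
by rewrite addrA subrK.
Qed.

Fact hmf_compA a b c d (h : even_cohomology c d) (g : even_cohomology b c)
    (f : even_cohomology a b) :
  hmf_comp h (hmf_comp g f) = hmf_comp (hmf_comp h g) f.
Proof.
have [h' ->] := mf_class_surj h; have [g' ->] := mf_class_surj g.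
have [f' ->] := mf_class_surj f; rewrite !hmf_compE; congr mf_class.
by apply: val_inj; rewrite /= comp_lfunA.
Qed.

Fact hmf_comp1m a b (f : even_cohomology a b) :
  hmf_comp (mf_class (cocycle_id b)) f = f.
Proof.
have [f' ->] := mf_class_surj f; rewrite hmf_compE; congr mf_class.
by apply: val_inj; rewrite /= comp_lfun1l.
Qed.

Fact hmf_compm1 a b (f : even_cohomology a b) :
  hmf_comp f (mf_class (cocycle_id a)) = f.
Proof.
have [f' ->] := mf_class_surj f; rewrite hmf_compE; congr mf_class.
by apply: val_inj; rewrite /= comp_lfun1r.
Qed.

Fact hmf_compDl a b c (g g' : even_cohomology b c) (f : even_cohomology a b) :
  hmf_comp (g + g') f = hmf_comp g f + hmf_comp g' f.
Proof.
have [h ->] := mf_class_surj g; have [h' ->] := mf_class_surj g'.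
have [k ->] := mf_class_surj f; rewrite -mf_classD !hmf_compE -mf_classD.
by congr mf_class; apply: val_inj; rewrite /= comp_lfunDl.
Qed.

Fact hmf_compDr a b c (g : even_cohomology b c) (f f' : even_cohomology a b) :
  hmf_comp g (f + f') = hmf_comp g f + hmf_comp g f'.
Proof.
have [h ->] := mf_class_surj f; have [h' ->] := mf_class_surj f'.
have [k ->] := mf_class_surj g; rewrite -mf_classD !hmf_compE -mf_classD.
by congr mf_class; apply: val_inj; rewrite /= comp_lfunDr.
Qed.

Definition hmf : preadditive :=
  Preadditive hmf_compA hmf_comp1m hmf_compm1 hmf_compDl hmf_compDr.

Definition elementary_factorization a : Prop :=
  dim (mf_even a) = 1%N /\ dim (mf_odd a) = 1%N.

Section Ev.
Variables (v u : R) (vu : v * u = W).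

(* The matrix (0 v; u 0) acting on column vectors. *)
Definition ev_fun (x : R^o * R^o) : R^o * R^o := (v * x.2, u * x.1).

Fact ev_fun_linear : linear ev_fun.
Proof.
move=> k x y; congr (_, _) => /=; rewrite mulrDr; congr (_ + _).
  by rewrite /GRing.scale /= mulrCA.
by rewrite /GRing.scale /= mulrCA.
Qed.
HB.instance Definition _ :=
  GRing.isLinear.Build R (R^o * R^o)%type (R^o * R^o)%type _ ev_fun
    ev_fun_linear.

Definition ev_D : 'End((R^o * R^o)%type) := linfun ev_fun.

Fact ev_D_odd : homogeneous true ev_D.
Proof.
by case=> x; rewrite /in_degree lfunE /= => ->; rewrite mulr0.
Qed.

Fact ev_D_sq : (ev_D \o ev_D)%VF = W *: \1%VF.
Proof.
apply/lfunP => -[x0 x1]; rewrite !lfun_simp /= /ev_fun /=.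
by congr (_, _); rewrite mulrA ?[u * v]mulrC vu.
Qed.

Definition ev : matrix_factorization W := MatrixFactorization ev_D_odd ev_D_sq.
End Ev.

Inductive primary_factorization : matrix_factorization W -> Prop :=
  PrimaryFactorization v u (vu : v * u = W) of primary_elt v :
    primary_factorization (ev vu).

(* The smallest class of objects of hmf containing the elementary
   factorizations and closed under finite direct sums; direct sums are
   determined up to isomorphism, so the class is closed under isomorphism. *)
Inductive in_bold_hef : hmf -> Prop :=
| BoldHefElementary (a : hmf) :
    elementary_factorization a -> in_bold_hef a
| BoldHefSum (n : nat) (F : 'I_n -> hmf) (X : hmf) :
    (forall i, in_bold_hef (F i)) -> direct_sum F X -> in_bold_hef X.

Definition bold_hef : preadditive := full_subcategory in_bold_hef.

End HMF.

(* Main.v *)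
Require Import Defs.
From HB Require Import structures.
From mathcomp Require Import all_boot all_algebra.
From mathcomp Require Import boolp ring.

(** Two facts about elementary factorizations drive the proof.

    First, chain maps between elementary factorizations are pairs of scalars
    [(r, s)], and homotopies are pairs of scalars too.  If [a] and [b] are
    comaximal and [a * b] divides [W], then [e_(a b)] is the direct sum of [e_a]
    and [e_b]: from [s a + t b = 1] one writes down the four structure maps
    ([ev_split]).  Moreover [e_v] is a zero object as soon as [v] and [W / v] are
    comaximal ([ev_zero]).

    Secondly, the endomorphism ring of [e_(p ^ n)], with [p] prime, is the
    quotient of [R] by [p ^ n] and [W / p ^ n].  In a Bezout domain a prime
    generates a maximal ideal, so this quotient is zero or local, the scalars
    divisible by [p] being its non-units ([ev_prime_power_local]).

    Given a divisor [v] of [W = W_0 W_c], stripping from [v] the powers of the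
    primes of [W_c] leaves a divisor [v_0] of [W_0].  In a Bezout domain coprime
    elements are comaximal, so all these factors are pairwise comaximal, and [v_0]
    is comaximal with [W / v_0], because a common divisor that is not a unit would
    be a critical divisor of [W_0].  Therefore [e_v] is a direct sum of primary factorizations,
    those which are zero objects being discarded ([ev_decomposes]).  Every
    elementary factorization is isomorphic to some [e_v], and decomposability
    is stable under direct sums, so it holds on the whole category.

    The rest is formal.  An object with a local endomorphism ring is
    indecomposable, because such a ring has only trivial idempotents; and an
    indecomposable object that decomposes into non-zero pieces is isomorphic to
    any one of them.  Direct sums exist by adding up block matrices. *)

Set Implicit Arguments.
Unset Strict Implicit.
Unset Printing Implicit Defensive.

Import GRing.Theory VectorInternalTheory.
Local Open Scope ring_scope.

(** * Comaximality and primes *)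

Definition comaximal (R : idomainType) (x y : R) : Prop :=
  exists s t, s * x + t * y = 1.

Section Comaximal.
Variable R : idomainType.
Implicit Types x y z p : R.

Lemma comaximalC x y : comaximal x y -> comaximal y x.
Proof. by case=> s [t e]; exists t, s; rewrite addrC. Qed.

Lemma comaximal1 x : comaximal x 1.
Proof. by exists 0, 1; rewrite mul0r add0r mulr1. Qed.

Lemma comaximalM x y z : comaximal x y -> comaximal x z -> comaximal x (y * z).
Proof.
case=> s [t e1] [s' [t' e2]].
exists (s * s' * x + s * t' * z + t * s' * y), (t * t').
rewrite -[RHS]mulr1 -{1}e1 -e2; ring.
Qed.

Lemma comaximalX x y n : comaximal x y -> comaximal x (y ^+ n).
Proof.
move=> xy; elim: n => [|n IH]; first exact: comaximal1.
by rewrite exprS; apply: comaximalM.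
Qed.

Lemma comaximal_prod (I : eqType) (r : seq I) (F : I -> R) x :
  (forall i, i \in r -> comaximal x (F i)) -> comaximal x (\prod_(i <- r) F i).
Proof.
move=> xF; rewrite big_seq; elim/big_rec: _ => [|i y ri xy].
  exact: comaximal1.
by apply: comaximalM => //; apply: xF.
Qed.

Lemma comaximal_dvdl x x' y : rdvd x' x -> comaximal x y -> comaximal x' y.
Proof. by case=> c -> [s [t e]]; exists (s * c), t; rewrite -mulrA. Qed.

Lemma comaximal_dvdr x y y' : rdvd y' y -> comaximal x y -> comaximal x y'.
Proof. by move=> yy' /comaximalC/(comaximal_dvdl yy')/comaximalC. Qed.

Lemma comaximal_dvd_mul x y z :
  comaximal x y -> rdvd x (y * z) -> rdvd x z.
Proof.
case=> s [t e] [c yz]; exists (s * z + t * c).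
by rewrite -[LHS]mul1r -e mulrDl -[t * y * z]mulrA yz mulrDl mulrA
  [s * x * z]mulrAC.
Qed.

Lemma rcoprime_comaximal x y :
  bezout_domain R -> rcoprime x y -> comaximal x y.
Proof.
move=> /(_ 2%N (fun i => if i == 0 then x else y)) [d dP] xy.
have dx : rdvd d x.
  apply/dP; exists (fun i => if i == 0 then 1 else 0).
  by rewrite !big_ord_recl big_ord0 /= mul1r mul0r !addr0.
have dy : rdvd d y.
  apply/dP; exists (fun i => if i == 0 then 0 else 1).
  by rewrite !big_ord_recl big_ord0 /= mul1r mul0r addr0 add0r.
have dU := xy d dx dy.
have /dP [c] : rdvd d 1 by exists d^-1; rewrite mulVr.
rewrite !big_ord_recl big_ord0 /= addr0 => e.
by eexists; eexists; rewrite e.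
Qed.

(** A prime generates a maximal ideal: every element outside it is coprime to
    the prime, hence comaximal with it. *)
Lemma prime_comaximal p x :
  bezout_domain R -> prime_elt p -> ~ rdvd p x -> comaximal p x.
Proof.
move=> bezR [p0 pU pP] px; apply: rcoprime_comaximal => // d [c pE] [e xE].
have [[b cE]|[b dE]] : rdvd p c \/ rdvd p d.
- by apply: pP; rewrite -pE; exists 1; rewrite mul1r.
- apply/unitrPr; exists b; apply: (mulIf p0).
  by rewrite mul1r -mulrA -cE mulrC -pE.
- by case: px; exists (e * b); rewrite -mulrA -dE.
Qed.

(** If [q = c p] then the prime [q] divides [c] or [p]; the former would make
    [p] a unit, the latter makes [c] one. *)
Lemma prime_nassoc_comaximal p q : bezout_domain R ->
  prime_elt p -> prime_elt q -> ~ associated p q -> comaximal p q.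
Proof.
move=> bezR pp [q0 qU qP] npq; apply: prime_comaximal => // -[c qE].
have [[b cE]|[b pE]] : rdvd q c \/ rdvd q p.
- by apply: qP; rewrite -qE; exists 1; rewrite mul1r.
- have [_ pU _] := pp; move/negP: pU; apply; apply/unitrPr; exists b.
  apply: (mulIf q0); rewrite mul1r [RHS]qE cE; ring.
- apply: npq; exists c => //; apply/unitrPr; exists b.
  by apply: (mulIf q0); rewrite mul1r -mulrA -pE -qE.
Qed.

(** Valuations may be infinite in a Bezout domain; here they are avoided, since
    each of the [n] copies of the prime divides one of the two factors. The
    cofactor [u'] serves to strip the next prime from [v']. *)
Lemma split_prime_power p x n : prime_elt p -> forall v u,
  v * u = p ^+ n * x ->
  exists k v' u', v = p ^+ k * v' /\ v' * u' = x.
Proof.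
move=> [p0 _ pP]; elim: n => [|n IH] v u e.
  by rewrite expr0 mul1r in e; exists 0%N, v, u; rewrite expr0 mul1r.
have [[b vE]|[b uE]] : rdvd p v \/ rdvd p u.
- by apply: pP; rewrite e exprS -mulrA mulrC; eexists.
- have [|k [v' [u' [bE e']]]] := IH b u.
    by apply: (mulfI p0); rewrite mulrA [p * b]mulrC -vE e exprS mulrA.
  by exists k.+1, v', u'; rewrite vE bE exprSr mulrAC.
- have [|k [v' [u' [vE e']]]] := IH v b.
    by apply: (mulfI p0); rewrite mulrCA [p * b]mulrC -uE e exprS mulrA.
  by exists k, v', u'.
Qed.

End Comaximal.

(** * Direct sums in a preadditive category *)

Section Preadditive.
Variable C : preadditive.
Implicit Types X Y Z : C.

Lemma comp0m X Y Z (f : mor X Y) : (0 : mor Y Z) \oc f = 0.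
Proof. by apply: (addrI (0 \oc f)); rewrite -compDl !addr0. Qed.

Lemma compm0 X Y Z (g : mor Y Z) : g \oc (0 : mor X Y) = 0.
Proof. by apply: (addrI (g \oc 0)); rewrite -compDr !addr0. Qed.

Lemma comp_suml X Y Z I (r : seq I) (P : pred I) (g : I -> mor Y Z)
    (f : mor X Y) :
  (\sum_(i <- r | P i) g i) \oc f = \sum_(i <- r | P i) g i \oc f.
Proof.
exact: (big_morph (fun h => h \oc f) (fun x y => compDl x y f) (comp0m Z f)).
Qed.

Lemma comp_sumr X Y Z I (r : seq I) (P : pred I) (g : mor Y Z)
    (f : I -> mor X Y) :
  g \oc (\sum_(i <- r | P i) f i) = \sum_(i <- r | P i) g \oc f i.
Proof. exact: (big_morph (fun h => g \oc h) (compDr g) (compm0 X g)). Qed.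

Lemma zero_objectP X : zero_object X <-> idm X = 0.
Proof.
split=> [/(_ X) [+ _]|X0 Y]; first exact.
split=> f g; first by rewrite -(compm1 f) -(compm1 g) X0 !compm0.
by rewrite -(comp1m f) -(comp1m g) X0 !comp0m.
Qed.

Lemma isomorphic_sym X Y : isomorphic X Y -> isomorphic Y X.
Proof. by case=> f [g [e1 e2]]; exists g, f. Qed.

Lemma zero_object_iso X Y : isomorphic X Y -> zero_object X -> zero_object Y.
Proof.
case=> f [g [_ fg]] /zero_objectP X0; apply/zero_objectP.
by rewrite -fg -(compm1 f) X0 compm0 comp0m.
Qed.

Lemma direct_sum_iso (I : finType) (F : I -> C) X Y :
  isomorphic X Y -> direct_sum F X -> direct_sum F Y.
Proof.
case=> f [g [gf fg]] [inj [prj [e1 e2 e3]]].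
exists (fun i => f \oc inj i), (fun i => prj i \oc g); split=> [i|i j ij|].
- by rewrite Defs.compA -[_ \oc _ \oc f]Defs.compA gf compm1.
- by rewrite Defs.compA -[_ \oc _ \oc f]Defs.compA gf compm1 e2.
- under eq_bigr => i _ do rewrite Defs.compA -[f \oc _ \oc _]Defs.compA.
  by rewrite -comp_suml -comp_sumr e3 compm1.
Qed.

Lemma direct_sum_reindex (I J : finType) (h : J -> I) (F : I -> C) X :
  bijective h -> direct_sum F X -> direct_sum (F \o h) X.
Proof.
move=> hB [inj [prj [e1 e2 e3]]].
exists (fun j => inj (h j)), (fun j => prj (h j)); split=> [j|j j' jj'|].
- exact: e1.
- by apply: e2; rewrite (inj_eq (bij_inj hB)).
- by rewrite -e3 (reindex h) //; apply: onW_bij.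
Qed.

Definition decomposes (P : C -> Prop) X : Prop :=
  exists (I : finType) (F : I -> C), (forall i, P (F i)) /\ direct_sum F X.

Lemma decomposes_zero (P : C -> Prop) X : zero_object X -> decomposes P X.
Proof.
move/zero_objectP=> X0; exists void, (fun i : void => match i with end).
split=> [[]|]; exists (fun i : void => match i with end).
exists (fun i : void => match i with end).
by split=> [[]|[]|]; rewrite big1 // => -[].
Qed.

Lemma decomposes_single (P : C -> Prop) X : P X -> decomposes P X.
Proof.
move=> PX; exists unit, (fun=> X); split=> //.
exists (fun=> idm X), (fun=> idm X).
split=> [i|[] []//|]; first exact: comp1m.
by rewrite (bigD1 tt) //= big1 ?addr0 ?comp1m // => -[].
Qed.

Lemma decomposes_iso P X Y : isomorphic X Y -> decomposes P X -> decomposes P Y.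
Proof.
by move=> XY [I [F [PF FX]]]; exists I, F; split=> //; apply: direct_sum_iso FX.
Qed.

(** The summands of the summands are indexed by a sigma type; index sets range
    over all finite types so that no renumbering is needed. *)
Lemma decomposes_sum (P : C -> Prop) (I : finType) (F : I -> C) X :
  (forall i, decomposes P (F i)) -> direct_sum F X -> decomposes P X.
Proof.
move=> PF [inj [prj [e1 e2 e3]]].
pose J i : finType := sval (cid (PF i)).
have PJ i : exists G : J i -> C, (forall j, P (G j)) /\ direct_sum G (F i).
  exact: svalP (cid (PF i)).
pose G i : J i -> C := sval (cid (PJ i)).
have PG i j : P (G i j) by case: (svalP (cid (PJ i))) => + _; apply.
have GF i : direct_sum (G i) (F i) by have [] := svalP (cid (PJ i)).
pose inj' i := sval (cid (GF i)).
pose prj' i := sval (cid (svalP (cid (GF i)))).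
have GFP i := svalP (cid (svalP (cid (GF i)))).
exists ({i : I & J i} : finType), (fun k => G (tag k) (tagged k)).
split=> [k|]; first exact: PG.
exists (fun k => inj (tag k) \oc inj' _ (tagged k)).
exists (fun k => prj' _ (tagged k) \oc prj (tag k)); split.
- case=> i j /=; rewrite Defs.compA -[_ \oc _ \oc inj i]Defs.compA e1 compm1.
  by case: (GFP i) => ->.
- case=> i j [i' j'] /=; rewrite Defs.compA -[_ \oc _ \oc inj i']Defs.compA.
  have [e|ii' _] := eqVneq i i'; last by rewrite e2 // compm0 comp0m.
  case: _ / e j' => j'; rewrite -tag_eqE /tag_eq /= eqxx tagged_asE e1 compm1.
  by case: (GFP i) => _ + _; apply.
transitivity
  (\sum_i \sum_(j : J i) inj i \oc inj' i j \oc (prj' i j \oc prj i)).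
  by rewrite sig_big_dep.
rewrite -e3; apply: eq_bigr => i _.
under eq_bigr => j _ do rewrite Defs.compA -[inj i \oc _ \oc _]Defs.compA.
rewrite -comp_suml -comp_sumr.
by case: (GFP i) => _ _ ->; rewrite compm1.
Qed.

Lemma decomposes_ord P X : decomposes P X ->
  exists (n : nat) (F : 'I_n -> C), (forall i, P (F i)) /\ direct_sum F X.
Proof.
case=> I [F [PF FX]]; exists #|I|, (F \o enum_val); split=> [i|].
  exact: PF.
by apply: direct_sum_reindex FX; apply: enum_val_bij.
Qed.

Lemma direct_sum_boolP X Y Z :
  direct_sum (fun b : bool => if b then X else Y) Z <->
  exists (i1 : mor X Z) (p1 : mor Z X) (i2 : mor Y Z) (p2 : mor Z Y),
    [/\ p1 \oc i1 = idm X, p2 \oc i2 = idm Y, p1 \oc i2 = 0, p2 \oc i1 = 0 &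
        i1 \oc p1 + i2 \oc p2 = idm Z].
Proof.
split=> [[inj [prj [e1 e2 e3]]]|[i1 [p1 [i2 [p2 [e1 e2 e3 e4 e5]]]]]].
  exists (inj true), (prj true), (inj false), (prj false).
  split; [exact: (e1 true)|exact: (e1 false)|exact: (e2 true false)|
    exact: (e2 false true)|].
  by rewrite -e3 big_bool.
exists (fun b => if b as b return mor (if b then X else Y) Z then i1 else i2).
exists (fun b => if b as b return mor Z (if b then X else Y) then p1 else p2).
by split=> [[]|[] []|] //; rewrite big_bool.
Qed.

(** Induction on the index set; the new summand is grafted onto a family of
    dependently typed injections with [dfwith]. *)
Lemma finite_direct_sums :
  (exists Z, zero_object Z) ->
  (forall X Y, exists Z, direct_sum (fun b : bool => if b then X else Y) Z) ->
  forall (I : finType) (F : I -> C), exists X, direct_sum F X.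
Proof.
move=> [Z /zero_objectP Z0] sum2 I F.
suff [X [inj [prj [e1 e2 e3]]]] : exists X (inj : forall i, mor (F i) X)
    (prj : forall i, mor X (F i)),
    [/\ forall i, i \in enum I -> prj i \oc inj i = idm (F i),
        forall i j, i \in enum I -> j \in enum I -> i != j ->
          prj i \oc inj j = 0 &
        \sum_(i <- enum I) inj i \oc prj i = idm X].
  exists X, inj, prj; split=> [i|i j|]; first by apply: e1; rewrite mem_enum.
    by apply: e2; rewrite mem_enum.
  by rewrite -e3 big_enum.
elim: (enum I) (enum_uniq I) => [_|i0 r IH /= /andP[i0r /IH]].
  by exists Z, (fun=> 0), (fun=> 0); split=> //; rewrite big_nil.
case=> [X [inj [prj [e1 e2 e3]]]].
have [Y /direct_sum_boolP [i1 [p1 [i2 [p2 [e11 e22 e12 e21 e3']]]]]] :=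
  sum2 (F i0) X.
have ner i : i \in r -> i0 != i by apply: contraTneq => <-.
exists Y, (dfwith (fun i => i2 \oc inj i) i1).
exists (dfwith (fun i => prj i \oc p2) p1).
have prj_inj i j : prj i \oc p2 \oc (i2 \oc inj j)
    = prj i \oc inj j.
  by rewrite Defs.compA -[_ \oc _ \oc i2]Defs.compA e22 compm1.
split=> [i|i j|].
- rewrite inE => /predU1P [->|ir]; first by rewrite !dfwith_in e11.
  by rewrite !dfwith_out ?ner // prj_inj e1.
- rewrite !inE => /predU1P [->|ir] /predU1P [->|jr] ij.
  + by rewrite eqxx in ij.
  + by rewrite dfwith_in dfwith_out ?ner // Defs.compA e12 comp0m.
  + by rewrite dfwith_in dfwith_out ?ner // -Defs.compA e21 compm0.
  + by rewrite !dfwith_out ?ner // prj_inj e2.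
- rewrite big_cons !dfwith_in -e3'; congr (_ + _).
  rewrite big_seq; under eq_bigr => i ir.
    rewrite !dfwith_out ?ner // Defs.compA -[i2 \oc _ \oc _]Defs.compA.
    over.
  by rewrite -big_seq -comp_suml -comp_sumr e3 compm1.
Qed.

(** * Local endomorphism rings *)

(** The ideal [I] consists of the elements without left inverse, so it contains
    every proper left ideal.  Unlike uniqueness of a maximal one, this form
    yields inverses directly, with no appeal to the existence of maximal ideals. *)
Definition local_endo X : Prop := exists I : mor X X -> Prop,
  [/\ I 0, forall x y, I x -> I y -> I (x + y), forall a x, I x -> I (a \oc x),
      ~ I (idm X) & forall x, ~ I x -> exists y, y \oc x = idm X].

Lemma local_endo_quasi_local X : local_endo X -> quasi_local (endo X).
Proof.
case=> I [I0 ID IM I1 IU].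
have maxI (J : endo X -> Prop) : left_ideal J -> ~ J 1 -> forall x, J x -> I x.
  case=> _ _ JM J1 x Jx; have [//|/IU [y yx]] := EM (I x).
  by case: J1; rewrite -[1]yx; apply: JM.
have idI : left_ideal (I : endo X -> Prop) by [].
exists I; split=> [|J [idJ J1 maxJ] x].
  by split=> // J idJ J1 _; apply: maxI.
by split=> [|/maxI]; [apply: maxJ => //; apply: maxI | apply].
Qed.

(** Of two complementary idempotents of a local ring one is invertible, hence
    equal to 1, so that the summand cut out by the other one vanishes. *)
Lemma local_endo_indecomposable X : local_endo X -> indecomposable X.
Proof.
case=> I [_ ID _ I1 IU] F [inj [prj [e1 e2 e3]]].
have other b : ~ I (inj b \oc prj b) -> zero_object (F (~~ b)).
  move=> /IU [y ye].
  have eb1 : inj b \oc prj b = idm X.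
    rewrite -[LHS]comp1m -ye -!Defs.compA; congr (y \oc (_ \oc _)).
    by rewrite Defs.compA e1 comp1m.
  apply/zero_objectP; rewrite -e1 -[inj _]comp1m -eb1 !Defs.compA.
  by rewrite e2 ?comp0m //; case: b {ye eb1}.
have [It|/other Ff] := EM (I (inj true \oc prj true)); last by exists false.
have [If|/other Ft] := EM (I (inj false \oc prj false)); last by exists true.
by case: I1; rewrite -e3 big_bool; apply: ID.
Qed.

Lemma indecomposable_iso X Y :
  isomorphic X Y -> indecomposable X -> indecomposable Y.
Proof.
by move=> /isomorphic_sym YX indX F /(direct_sum_iso YX); apply: indX.
Qed.

(** Grouping all summands but one into a single object [Z] presents [X] as a
    binary sum; since the singled out summand survives, [Z] has to vanish. *)
Lemma indecomposable_decomposes (P : C -> Prop) X :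
  (forall (I : finType) (F : I -> C), exists Y, direct_sum F Y) ->
  (forall Y, P Y -> ~ zero_object Y) ->
  decomposes P X -> ~ zero_object X -> indecomposable X ->
  exists Y, P Y /\ isomorphic X Y.
Proof.
move=> sums Pnz [I [F [PF FX]]] Xnz indX.
have [inj [prj [e1 e2 e3]]] := FX.
have [i0 _|I0] := pickP (fun _ : I => true); last first.
  case: Xnz; apply/zero_objectP; rewrite -e3 big1 // => i.
  by have := I0 i.
have [Z [injZ [prjZ [z1 z2 z3]]]] :=
  sums {i in predC1 i0} (fun k => F (val k)).
pose iZ : mor Z X := \sum_k inj (val k) \oc prjZ k.
pose pZ : mor X Z := \sum_k injZ k \oc prj (val k).
have prjZ_pZ k : prjZ k \oc pZ = prj (val k).
  rewrite comp_sumr (bigD1 k) //= big1 ?addr0 => [|l lk].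
    by rewrite Defs.compA z1 comp1m.
  by rewrite Defs.compA z2 1?eq_sym // comp0m.
have prj_iZ k : prj (val k) \oc iZ = prjZ k.
  rewrite comp_sumr (bigD1 k) //= big1 ?addr0 => [|l lk].
    by rewrite Defs.compA e1 comp1m.
  by rewrite Defs.compA e2 ?comp0m // (inj_eq val_inj) eq_sym.
have sumXZ : inj i0 \oc prj i0 + iZ \oc pZ = idm X.
  rewrite -e3 [RHS](bigD1 i0) //=; congr (_ + _).
  rewrite -[RHS]/(\sum_(i in predC1 i0) inj i \oc prj i) big_sub comp_suml.
  by apply: eq_bigr => k _; rewrite -Defs.compA prjZ_pZ.
have [|[] Y0] := indX (fun b : bool => if b then F i0 else Z).
- apply/direct_sum_boolP; exists (inj i0), (prj i0), iZ, pZ; split.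
  + exact: e1.
  + by rewrite -z3 comp_suml; apply: eq_bigr => k _; rewrite -Defs.compA prj_iZ.
  + rewrite comp_sumr big1 // => k _.
    by rewrite Defs.compA e2 ?comp0m // eq_sym; have := valP k; rewrite inE.
  + rewrite comp_suml big1 // => k _.
    by rewrite -Defs.compA e2 ?compm0 //; have := valP k; rewrite inE.
  + exact: sumXZ.
- by case: (Pnz _ (PF i0)).
exists (F i0); split=> //; exists (prj i0), (inj i0).
split; last exact: e1.
by rewrite -sumXZ -[pZ]comp1m (zero_objectP Z).1 // comp0m compm0 addr0.
Qed.

End Preadditive.

(** * Block form of even and odd maps *)

Section Blocks.
Variable R : idomainType.
Implicit Types M N L : vectType R.

Definition even_fun M0 M1 N0 N1 (f0 : 'Hom(M0, N0)) (f1 : 'Hom(M1, N1))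
    (x : M0 * M1) : N0 * N1 := (f0 x.1, f1 x.2).

Fact even_fun_linear M0 M1 N0 N1 (f0 : 'Hom(M0, N0)) (f1 : 'Hom(M1, N1)) :
  linear (even_fun f0 f1).
Proof. by move=> k x y; rewrite /even_fun /= !linearP. Qed.
HB.instance Definition _ M0 M1 N0 N1 (f0 : 'Hom(M0, N0)) (f1 : 'Hom(M1, N1)) :=
  GRing.isLinear.Build R (M0 * M1)%type (N0 * N1)%type _ (even_fun f0 f1)
    (even_fun_linear f0 f1).

Definition even_map M0 M1 N0 N1 (f0 : 'Hom(M0, N0)) (f1 : 'Hom(M1, N1)) :
    'Hom((M0 * M1)%type, (N0 * N1)%type) := linfun (even_fun f0 f1).

Definition odd_fun M0 M1 N0 N1 (h0 : 'Hom(M1, N0)) (h1 : 'Hom(M0, N1))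
    (x : M0 * M1) : N0 * N1 := (h0 x.2, h1 x.1).

Fact odd_fun_linear M0 M1 N0 N1 (h0 : 'Hom(M1, N0)) (h1 : 'Hom(M0, N1)) :
  linear (odd_fun h0 h1).
Proof. by move=> k x y; rewrite /odd_fun /= !linearP. Qed.
HB.instance Definition _ M0 M1 N0 N1 (h0 : 'Hom(M1, N0)) (h1 : 'Hom(M0, N1)) :=
  GRing.isLinear.Build R (M0 * M1)%type (N0 * N1)%type _ (odd_fun h0 h1)
    (odd_fun_linear h0 h1).

Definition odd_map M0 M1 N0 N1 (h0 : 'Hom(M1, N0)) (h1 : 'Hom(M0, N1)) :
    'Hom((M0 * M1)%type, (N0 * N1)%type) := linfun (odd_fun h0 h1).

Lemma even_mapE M0 M1 N0 N1 (f0 : 'Hom(M0, N0)) (f1 : 'Hom(M1, N1)) x :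
  even_map f0 f1 x = (f0 x.1, f1 x.2).
Proof. exact: lfunE. Qed.

Lemma odd_mapE M0 M1 N0 N1 (h0 : 'Hom(M1, N0)) (h1 : 'Hom(M0, N1)) x :
  odd_map h0 h1 x = (h0 x.2, h1 x.1).
Proof. exact: lfunE. Qed.

Lemma even_map_homogeneous M0 M1 N0 N1 (f0 : 'Hom(M0, N0)) (f1 : 'Hom(M1, N1)) :
  homogeneous false (even_map f0 f1).
Proof. by case=> x; rewrite /in_degree even_mapE /= => ->; rewrite linear0. Qed.

Lemma odd_map_homogeneous M0 M1 N0 N1 (h0 : 'Hom(M1, N0)) (h1 : 'Hom(M0, N1)) :
  homogeneous true (odd_map h0 h1).
Proof. by case=> x; rewrite /in_degree odd_mapE /= => ->; rewrite linear0. Qed.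

Lemma even_even M0 M1 N0 N1 L0 L1 (f0 : 'Hom(N0, L0)) (f1 : 'Hom(N1, L1))
    (g0 : 'Hom(M0, N0)) (g1 : 'Hom(M1, N1)) :
  (even_map f0 f1 \o even_map g0 g1 = even_map (f0 \o g0) (f1 \o g1))%VF.
Proof. by apply/lfunP => x; rewrite !(comp_lfunE, even_mapE). Qed.

Lemma even_odd M0 M1 N0 N1 L0 L1 (f0 : 'Hom(N0, L0)) (f1 : 'Hom(N1, L1))
    (g0 : 'Hom(M1, N0)) (g1 : 'Hom(M0, N1)) :
  (even_map f0 f1 \o odd_map g0 g1 = odd_map (f0 \o g0) (f1 \o g1))%VF.
Proof. by apply/lfunP => x; rewrite !(comp_lfunE, even_mapE, odd_mapE). Qed.

Lemma odd_even M0 M1 N0 N1 L0 L1 (f0 : 'Hom(N1, L0)) (f1 : 'Hom(N0, L1))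
    (g0 : 'Hom(M0, N0)) (g1 : 'Hom(M1, N1)) :
  (odd_map f0 f1 \o even_map g0 g1 = odd_map (f0 \o g1) (f1 \o g0))%VF.
Proof. by apply/lfunP => x; rewrite !(comp_lfunE, even_mapE, odd_mapE). Qed.

Lemma odd_odd M0 M1 N0 N1 L0 L1 (f0 : 'Hom(N1, L0)) (f1 : 'Hom(N0, L1))
    (g0 : 'Hom(M1, N0)) (g1 : 'Hom(M0, N1)) :
  (odd_map f0 f1 \o odd_map g0 g1 = even_map (f0 \o g1) (f1 \o g0))%VF.
Proof. by apply/lfunP => x; rewrite !(comp_lfunE, even_mapE, odd_mapE). Qed.

Lemma even_mapD M0 M1 N0 N1 (f0 g0 : 'Hom(M0, N0)) (f1 g1 : 'Hom(M1, N1)) :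
  even_map f0 f1 + even_map g0 g1 = even_map (f0 + g0) (f1 + g1).
Proof. by apply/lfunP => x; rewrite !(add_lfunE, even_mapE). Qed.

Lemma odd_mapD M0 M1 N0 N1 (f0 g0 : 'Hom(M1, N0)) (f1 g1 : 'Hom(M0, N1)) :
  odd_map f0 f1 + odd_map g0 g1 = odd_map (f0 + g0) (f1 + g1).
Proof. by apply/lfunP => x; rewrite !(add_lfunE, odd_mapE). Qed.

Lemma even_mapB M0 M1 N0 N1 (f0 g0 : 'Hom(M0, N0)) (f1 g1 : 'Hom(M1, N1)) :
  even_map f0 f1 - even_map g0 g1 = even_map (f0 - g0) (f1 - g1).
Proof. by apply/lfunP => x; rewrite !(add_lfunE, opp_lfunE, even_mapE). Qed.

Lemma even_mapZ M0 M1 N0 N1 k (f0 : 'Hom(M0, N0)) (f1 : 'Hom(M1, N1)) :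
  k *: even_map f0 f1 = even_map (k *: f0) (k *: f1).
Proof. by apply/lfunP => x; rewrite !(scale_lfunE, even_mapE). Qed.

Lemma even_map1 M0 M1 : even_map \1%VF \1%VF = (\1%VF : 'End((M0 * M1)%type)).
Proof. by apply/lfunP => x; rewrite even_mapE !id_lfunE -surjective_pairing. Qed.

Lemma even_map_inj M0 M1 N0 N1 (f0 g0 : 'Hom(M0, N0)) (f1 g1 : 'Hom(M1, N1)) :
  even_map f0 f1 = even_map g0 g1 -> f0 = g0 /\ f1 = g1.
Proof.
move=> /lfunP e; split; apply/lfunP => x.
  by have := e (x, 0); rewrite !even_mapE /= => -[].
by have := e (0, x); rewrite !even_mapE /= => -[].
Qed.

Lemma odd_map_inj M0 M1 N0 N1 (f0 g0 : 'Hom(M1, N0)) (f1 g1 : 'Hom(M0, N1)) :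
  odd_map f0 f1 = odd_map g0 g1 -> f0 = g0 /\ f1 = g1.
Proof.
move=> /lfunP e; split; apply/lfunP => x.
  by have := e (0, x); rewrite !odd_mapE /= => -[].
by have := e (x, 0); rewrite !odd_mapE /= => -[].
Qed.

End Blocks.

Section Components.
Variables (R : idomainType).
Implicit Types M N L : vectType R.

Definition inl_fun M N (x : M) : M * N := (x, 0).
Definition inr_fun M N (x : N) : M * N := (0, x).

Fact inl_fun_linear M N : linear (@inl_fun M N).
Proof. by move=> k x y; congr (_, _); rewrite /= scaler0 addr0. Qed.
HB.instance Definition _ M N :=
  GRing.isLinear.Build R M (M * N)%type _ (@inl_fun M N)
    (@inl_fun_linear M N).

Fact inr_fun_linear M N : linear (@inr_fun M N).
Proof. by move=> k x y; congr (_, _); rewrite /= scaler0 addr0. Qed.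
HB.instance Definition _ M N :=
  GRing.isLinear.Build R N (M * N)%type _ (@inr_fun M N)
    (@inr_fun_linear M N).

Definition inl_map M N : 'Hom(M, (M * N)%type) := linfun (@inl_fun M N).
Definition inr_map M N : 'Hom(N, (M * N)%type) := linfun (@inr_fun M N).
Definition fst_map M N : 'Hom((M * N)%type, M) := linfun fst.
Definition snd_map M N : 'Hom((M * N)%type, N) := linfun snd.

Lemma inl_mapE M N x : inl_map M N x = (x, 0). Proof. exact: lfunE. Qed.
Lemma inr_mapE M N x : inr_map M N x = (0, x). Proof. exact: lfunE. Qed.
Lemma fst_mapE M N x : fst_map M N x = x.1. Proof. exact: lfunE. Qed.
Lemma snd_mapE M N x : snd_map M N x = x.2. Proof. exact: lfunE. Qed.
Definition component_mapE := (inl_mapE, inr_mapE, fst_mapE, snd_mapE).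

Lemma fst_inl M N : (fst_map M N \o inl_map M N)%VF = \1%VF.
Proof. by apply/lfunP => x; rewrite !(comp_lfunE, component_mapE) id_lfunE. Qed.
Lemma snd_inr M N : (snd_map M N \o inr_map M N)%VF = \1%VF.
Proof. by apply/lfunP => x; rewrite !(comp_lfunE, component_mapE) id_lfunE. Qed.
Lemma fst_inr M N : (fst_map M N \o inr_map M N)%VF = 0.
Proof. by apply/lfunP => x; rewrite !(comp_lfunE, component_mapE) zero_lfunE. Qed.
Lemma snd_inl M N : (snd_map M N \o inl_map M N)%VF = 0.
Proof. by apply/lfunP => x; rewrite !(comp_lfunE, component_mapE) zero_lfunE. Qed.
Lemma inl_fst_inr_snd M N :
  ((inl_map M N \o fst_map M N) + (inr_map M N \o snd_map M N))%VF = \1%VF.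
Proof.
apply/lfunP => -[x y]; rewrite !(add_lfunE, comp_lfunE, component_mapE) id_lfunE.
by congr (_, _); rewrite /= ?addr0 ?add0r.
Qed.

Lemma even_blocks M0 M1 N0 N1 (f : 'Hom((M0 * M1)%type, (N0 * N1)%type)) :
  homogeneous false f -> exists f0 f1, f = even_map f0 f1.
Proof.
move=> hf; exists (fst_map N0 N1 \o f \o inl_map M0 M1)%VF.
exists (snd_map N0 N1 \o f \o inr_map M0 M1)%VF.
apply/lfunP => x; rewrite even_mapE !(comp_lfunE, component_mapE).
have := hf false (x.1, 0) erefl; have := hf true (0, x.2) erefl.
rewrite /in_degree /= => f1 f0.
have -> : x = (x.1, 0) + (0, x.2).
  by case: x {f0 f1} => x y; congr (_, _); rewrite /= ?addr0 ?add0r.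
rewrite linearD /= addr0 add0r [LHS]surjective_pairing.
by congr (_, _); rewrite /= ?f0 ?f1 ?addr0 ?add0r.
Qed.

Lemma odd_blocks M0 M1 N0 N1 (h : 'Hom((M0 * M1)%type, (N0 * N1)%type)) :
  homogeneous true h -> exists h0 h1, h = odd_map h0 h1.
Proof.
move=> hh; exists (fst_map N0 N1 \o h \o inr_map M0 M1)%VF.
exists (snd_map N0 N1 \o h \o inl_map M0 M1)%VF.
apply/lfunP => x; rewrite odd_mapE !(comp_lfunE, component_mapE).
have := hh false (x.1, 0) erefl; have := hh true (0, x.2) erefl.
rewrite /in_degree /= => h1 h0.
have -> : x = (x.1, 0) + (0, x.2).
  by case: x {h0 h1} => x y; congr (_, _); rewrite /= ?addr0 ?add0r.
rewrite linearD /= addr0 add0r [LHS]surjective_pairing.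
by congr (_, _); rewrite /= ?h0 ?h1 ?addr0 ?add0r.
Qed.

End Components.

(** * Morphisms of matrix factorizations *)

Section Morphisms.
Variables (R : idomainType) (W : R).
Implicit Types a b c : matrix_factorization W.

Fact strict_even_cocycle a b (f : 'Hom(mf_mod a, mf_mod b)) :
  homogeneous false f -> (mf_D b \o f = f \o mf_D a)%VF ->
  f \in @even_cocycle R W a b.
Proof.
move=> hf df; apply/asboolP; split=> //.
by rewrite /mf_diff expr0 scale1r df subrr.
Qed.

(** Homotopies are odd, hence given by their two off-diagonal blocks. *)
Lemma mf_class_eqP a b (f g : cocycle a b) :
  mf_class f = mf_class g <->
  exists h0 h1,
    val f - val g = ((mf_D b \o odd_map h0 h1) + (odd_map h0 h1 \o mf_D a))%VF.
Proof.
split=> [/mf_classP/asboolP [h hh e]|[h0 [h1 e]]].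
  have [h0 [h1 hE]] := odd_blocks hh; exists h0, h1.
  by rewrite -hE; move: e; rewrite /mf_diff expr1 scaleN1r opprK raddfB.
apply/mf_classP/asboolP; exists (odd_map h0 h1).
  exact: odd_map_homogeneous.
by rewrite /mf_diff expr1 scaleN1r opprK raddfB.
Qed.

Lemma mf_class_val a b (f g : cocycle a b) :
  val f = val g -> mf_class f = mf_class g.
Proof. by move=> e; congr mf_class; apply: val_inj. Qed.

End Morphisms.

Section Represents.
Variables (R : idomainType) (W : R).
Implicit Types a b c : hmf W.

(** Computing with a chain map [F] chosen in the homotopy class [f] keeps the
    cocycle proofs out of sight. *)
Definition represents a b (f : mor a b) (F : 'Hom(mf_mod a, mf_mod b)) : Prop :=
  exists2 c : cocycle a b, f = mf_class c & val c = F.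

Lemma represents_ex a b (F : 'Hom(mf_mod a, mf_mod b)) :
  homogeneous false F -> (mf_D b \o F = F \o mf_D a)%VF ->
  exists f : mor a b, represents f F.
Proof.
move=> hF dF; exists (mf_class (Cocycle (strict_even_cocycle hF dF))).
by eexists; first reflexivity.
Qed.

Lemma represents_surj a b (f : mor a b) :
  exists F0 F1, represents f (even_map F0 F1) /\
    (mf_D b \o even_map F0 F1 = even_map F0 F1 \o mf_D a)%VF.
Proof.
have [c ->] := mf_class_surj f.
have /asboolP [/even_blocks [F0 [F1 cE]]] := cocycleP c.
rewrite /mf_diff expr0 scale1r => /subr0_eq dc; exists F0, F1; split.
  by exists c.
by rewrite -cE.
Qed.

Lemma represents_id a : represents (idm a) \1%VF.
Proof. by exists (cocycle_id a). Qed.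

Lemma represents0 a b : represents (0 : mor a b) 0.
Proof.
exists 0; last exact: raddf0.
by apply: (addrI (mf_class 0)); rewrite -mf_classD !addr0.
Qed.

Lemma represents_comp a b c (g : mor b c) (f : mor a b) G F :
  represents g G -> represents f F -> represents (g \oc f) (G \o F)%VF.
Proof.
case=> k -> <- [l -> <-]; exists (cocycle_comp k l) => //.
exact: hmf_compE.
Qed.

Lemma representsD a b (f g : mor a b) F G :
  represents f F -> represents g G -> represents (f + g) (F + G).
Proof.
by case=> k -> <- [l -> <-]; exists (k + l); rewrite ?mf_classD ?raddfD.
Qed.

Lemma represents_inj a b (f g : mor a b) F :
  represents f F -> represents g F -> f = g.
Proof. by case=> k -> <- [l -> e]; apply: mf_class_val. Qed.

Lemma represents_eqP a b (f g : mor a b) F G :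
  represents f F -> represents g G ->
  f = g <-> exists h0 h1,
    F - G = ((mf_D b \o odd_map h0 h1) + (odd_map h0 h1 \o mf_D a))%VF.
Proof. by case=> k -> <- [l -> <-]; apply: mf_class_eqP. Qed.

End Represents.

(** * Binary direct sums of matrix factorizations *)

Section BinarySum.
Variables (R : idomainType) (W : R) (a b : matrix_factorization W).

Let A0 := mf_even a. Let A1 := mf_odd a. Let B0 := mf_even b. Let B1 := mf_odd b.

Let ia := even_map (inl_map A0 B0) (inl_map A1 B1).
Let ib := even_map (inr_map A0 B0) (inr_map A1 B1).
Let pa := even_map (fst_map A0 B0) (fst_map A1 B1).
Let pb := even_map (snd_map A0 B0) (snd_map A1 B1).

(** The structure maps satisfy the biproduct identities strictly, which
    reduces the properties of this differential to those of its summands. *)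
Definition sum_D : 'End(((A0 * B0) * (A1 * B1))%type) :=
  ((ia \o mf_D a \o pa) + (ib \o mf_D b \o pb))%VF.

Let paia : (pa \o ia = \1)%VF. Proof. by rewrite even_even !fst_inl even_map1. Qed.
Let pbib : (pb \o ib = \1)%VF. Proof. by rewrite even_even !snd_inr even_map1. Qed.
Let even_map0 (M0 M1 N0 N1 : vectType R) :
  even_map (0 : 'Hom(M0, N0)) (0 : 'Hom(M1, N1)) = 0.
Proof. by apply/lfunP => x; rewrite even_mapE !zero_lfunE. Qed.
Let paib : (pa \o ib = 0)%VF. Proof. by rewrite even_even !fst_inr even_map0. Qed.
Let pbia : (pb \o ia = 0)%VF. Proof. by rewrite even_even !snd_inl even_map0. Qed.
Let iapa_ibpb : ((ia \o pa) + (ib \o pb))%VF = \1%VF.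
Proof. by rewrite !even_even even_mapD !inl_fst_inr_snd even_map1. Qed.

Let paD : (pa \o sum_D = mf_D a \o pa)%VF.
Proof.
by rewrite comp_lfunDr !comp_lfunA paia paib !comp_lfun0l addr0 comp_lfun1l.
Qed.
Let pbD : (pb \o sum_D = mf_D b \o pb)%VF.
Proof.
by rewrite comp_lfunDr !comp_lfunA pbia pbib !comp_lfun0l add0r comp_lfun1l.
Qed.
Let Dia : (sum_D \o ia = ia \o mf_D a)%VF.
Proof.
by rewrite comp_lfunDl -!comp_lfunA paia pbia !comp_lfun0r addr0 comp_lfun1r.
Qed.
Let Dib : (sum_D \o ib = ib \o mf_D b)%VF.
Proof.
by rewrite comp_lfunDl -!comp_lfunA paib pbib !comp_lfun0r add0r comp_lfun1r.
Qed.

Fact sum_D_odd : homogeneous true sum_D.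
Proof.
rewrite /sum_D.
have [h0 [h1 ->]] := odd_blocks (mf_D_odd (m := a)).
have [k0 [k1 ->]] := odd_blocks (mf_D_odd (m := b)).
by rewrite !even_odd !odd_even odd_mapD; apply: odd_map_homogeneous.
Qed.

Fact sum_D_sq : (sum_D \o sum_D)%VF = W *: \1%VF.
Proof.
rewrite comp_lfunDl -!comp_lfunA paD pbD !(comp_lfunA (mf_D _)) !mf_D_sq.
by rewrite -!comp_lfunZl -!comp_lfunZr -scalerDr !comp_lfun1l iapa_ibpb.
Qed.

Definition mf_sum : hmf W := MatrixFactorization sum_D_odd sum_D_sq.

Lemma mf_sum_direct :
  direct_sum (fun c : bool => if c then a : hmf W else b) mf_sum.
Proof.
have even0 M0 M1 N0 N1 := @even_map_homogeneous R M0 M1 N0 N1.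
have [i1 i1E] := represents_ex (a := a) (b := mf_sum) (even0 _ _ _ _ _ _) Dia.
have [i2 i2E] := represents_ex (a := b) (b := mf_sum) (even0 _ _ _ _ _ _) Dib.
have [p1 p1E] := represents_ex (a := mf_sum) (b := a)
  (even0 _ _ _ _ _ _) (esym paD).
have [p2 p2E] := represents_ex (a := mf_sum) (b := b)
  (even0 _ _ _ _ _ _) (esym pbD).
apply/direct_sum_boolP; exists i1, p1, i2, p2; split.
- by have := represents_comp p1E i1E; rewrite paia => e;
    apply: represents_inj e (represents_id _).
- by have := represents_comp p2E i2E; rewrite pbib => e;
    apply: represents_inj e (represents_id _).
- by have := represents_comp p1E i2E; rewrite paib => e;
    apply: represents_inj e (represents0 _ _).
- by have := represents_comp p2E i1E; rewrite pbia => e;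
    apply: represents_inj e (represents0 _ _).
- have := representsD (represents_comp i1E p1E) (represents_comp i2E p2E).
  by rewrite iapa_ibpb => e; apply: represents_inj e (represents_id _).
Qed.

End BinarySum.

(** * Elementary factorizations *)

Section Elementary.
Variables (R : idomainType) (W : R).

(** Endomorphisms of the rank one module are scalars, see [endo_sc]. *)
Definition sc (r : R) : 'End(R^o : vectType R) := r *: \1%VF.

Lemma scM r s : (sc r \o sc s)%VF = sc (r * s).
Proof. by rewrite /sc -comp_lfunZl -comp_lfunZr comp_lfun1l scalerA. Qed.

Lemma scD r s : sc r + sc s = sc (r + s).
Proof. by rewrite /sc scalerDl. Qed.

Lemma scB r s : sc r - sc s = sc (r - s).
Proof. by rewrite /sc scalerBl. Qed.

Lemma sc1 : sc 1 = \1%VF.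
Proof. exact: scale1r. Qed.

Lemma scE r (x : R^o) : sc r x = r * x.
Proof. by rewrite scale_lfunE id_lfunE. Qed.

Lemma sc_inj : injective sc.
Proof. by move=> r s /lfunP/(_ 1); rewrite !scE !mulr1. Qed.

Lemma endo_sc (f : 'End(R^o : vectType R)) : exists r, f = sc r.
Proof.
exists (f 1); apply/lfunP => x; rewrite scE mulrC -[LHS]/(f x).
by rewrite -[x in LHS]mulr1 -[x * 1]/(x *: (1 : R^o)) linearZ.
Qed.

Lemma ev_DE v u : ev_D v u = odd_map (sc v) (sc u).
Proof. by apply/lfunP => x; rewrite odd_mapE !scE lfunE. Qed.

Definition ev_map (r s : R) : 'End((R^o * R^o)%type) := even_map (sc r) (sc s).

Lemma ev_map_comp r s r' s' :
  (ev_map r s \o ev_map r' s')%VF = ev_map (r * r') (s * s').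
Proof. by rewrite /ev_map even_even !scM. Qed.

Lemma ev_mapD r s r' s' : ev_map r s + ev_map r' s' = ev_map (r + r') (s + s').
Proof. by rewrite /ev_map even_mapD !scD. Qed.

Lemma ev_map1 : ev_map 1 1 = \1%VF.
Proof. by rewrite /ev_map !sc1 even_map1. Qed.

Lemma ev_map0 : ev_map 0 0 = 0.
Proof.
by apply/lfunP => x; rewrite even_mapE !scE !mul0r zero_lfunE.
Qed.

Variables (v1 u1 v2 u2 : R) (e1 : v1 * u1 = W) (e2 : v2 * u2 = W).
Let E1 : hmf W := ev e1.
Let E2 : hmf W := ev e2.

Lemma ev_represents_ex r s :
  v2 * s = r * v1 -> u2 * r = s * u1 ->
  exists f : mor E1 E2, represents f (ev_map r s).
Proof.
move=> h1 h2; apply: represents_ex; first exact: even_map_homogeneous.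
by rewrite /= !ev_DE odd_even even_odd !scM h1 h2.
Qed.

(** The two scalar conditions express that [(r, s)] is a chain map; for
    [v1 = v2 != 0] the first of them forces [r = s]. *)
Lemma ev_represents_surj (f : mor E1 E2) :
  exists r s, [/\ represents f (ev_map r s), v2 * s = r * v1 & u2 * r = s * u1].
Proof.
have [F0 [F1 []]] := represents_surj f.
have [r ->] := endo_sc F0; have [s ->] := endo_sc F1.
rewrite /= !ev_DE odd_even even_odd !scM => fE.
by case/odd_map_inj=> /sc_inj h1 /sc_inj h2; exists r, s.
Qed.

Lemma ev_represents_eqP (f g : mor E1 E2) r s r' s' :
  represents f (ev_map r s) -> represents g (ev_map r' s') ->
  f = g <-> exists h0 h1,
    r - r' = v2 * h1 + h0 * u1 /\ s - s' = u2 * h0 + h1 * v1.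
Proof.
move=> fE gE; rewrite (represents_eqP fE gE).
rewrite /= !ev_DE /ev_map even_mapB !scB; split=> [[H0 [H1]]|[h0 [h1 [h h']]]].
  have [h0 ->] := endo_sc H0; have [h1 ->] := endo_sc H1.
  rewrite !odd_odd even_mapD !scM !scD => /even_map_inj [/sc_inj h /sc_inj h'].
  by exists h0, h1.
exists (sc h0), (sc h1).
by rewrite !odd_odd even_mapD !scM !scD h h'.
Qed.

End Elementary.

Section ElementaryObjects.
Variables (R : idomainType) (W : R).

Lemma ev_represents_id v u (e : v * u = W) :
  represents (idm (ev e : hmf W)) (ev_map 1 1).
Proof. by rewrite ev_map1; apply: represents_id. Qed.

Lemma ev_represents0 v1 u1 v2 u2 (e1 : v1 * u1 = W) (e2 : v2 * u2 = W) :
  represents (0 : mor (ev e1 : hmf W) (ev e2)) (ev_map 0 0).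
Proof. by rewrite ev_map0; apply: represents0. Qed.

(** If [s v + t u = 1], then [t] and [s] are the blocks of a null-homotopy of the
    identity. *)
Lemma ev_zero v u (e : v * u = W) :
  comaximal v u -> zero_object (ev e : hmf W).
Proof.
case=> s [t st]; apply/zero_objectP.
apply/(ev_represents_eqP (ev_represents_id e) (ev_represents0 e e)).
by exists t, s; rewrite subr0 -st; split; ring.
Qed.

(** For comaximal [a] and [b], say [s a + t b = 1], the strict maps with diagonal
    entries [(b, 1)] and [(a, 1)] embed [e_a] and [e_b] into [e_ab], and those
    with entries [t (1, b)] and [s (1, a)] project back.  The two idempotents
    are [t b] and [s a], whose sum is 1 on the nose, while [t b] is homotopic
    to 1 on [e_a] and [s a] to 1 on [e_b]. *)
Lemma ev_split a b u (e : a * b * u = W) (ea : a * (b * u) = W)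
    (eb : b * (a * u) = W) :
  comaximal a b ->
  direct_sum (fun c : bool => if c then ev ea : hmf W else ev eb) (ev e).
Proof.
case=> s [t st].
have [i1 i1E] : exists i1 : mor (ev ea : hmf W) (ev e),
    represents i1 (ev_map b 1).
  by apply: ev_represents_ex; ring.
have [p1 p1E] : exists p1 : mor (ev e : hmf W) (ev ea),
    represents p1 (ev_map t (t * b)).
  by apply: ev_represents_ex; ring.
have [i2 i2E] : exists i2 : mor (ev eb : hmf W) (ev e),
    represents i2 (ev_map a 1).
  by apply: ev_represents_ex; ring.
have [p2 p2E] : exists p2 : mor (ev e : hmf W) (ev eb),
    represents p2 (ev_map s (s * a)).
  by apply: ev_represents_ex; ring.
apply/direct_sum_boolP; exists i1, p1, i2, p2; split.
- have := represents_comp p1E i1E; rewrite ev_map_comp => h.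
  apply/(ev_represents_eqP h (ev_represents_id ea)).
  by exists 0, (- s); rewrite mulr1 -st; split; ring.
- have := represents_comp p2E i2E; rewrite ev_map_comp => h.
  apply/(ev_represents_eqP h (ev_represents_id eb)).
  by exists 0, (- t); rewrite mulr1 -st; split; ring.
- have := represents_comp p1E i2E; rewrite ev_map_comp => h.
  apply/(ev_represents_eqP h (ev_represents0 _ _)).
  by exists 0, t; split; ring.
- have := represents_comp p2E i1E; rewrite ev_map_comp => h.
  apply/(ev_represents_eqP h (ev_represents0 _ _)).
  by exists 0, s; split; ring.
- have := representsD (represents_comp i1E p1E) (represents_comp i2E p2E).
  rewrite !ev_map_comp ev_mapD => h.
  apply/(ev_represents_eqP h (ev_represents_id e)).
  by exists 0, 0; rewrite !mul1r -st; split; ring.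
Qed.

(** Endomorphisms are scalars [r], and those divisible by [p] form the maximal
    ideal: when [p] does not divide [r], the scalar [r] is invertible modulo
    [p ^ n].  The ideal is proper because null-homotopic scalars are combinations
    of [p ^ n] and [u], which are both divisible by [p]. *)
Lemma ev_prime_power_local p n u (e : p ^+ n * u = W) :
  bezout_domain R -> prime_elt p -> (0 < n)%N -> rdvd p u ->
  local_endo (ev e : hmf W).
Proof.
move=> bezR pp n0 [c uE]; have [p0 pU pP] := pp.
have pdvd0 : rdvd p 0 by exists 0; rewrite mul0r.
have pn : exists q, p ^+ n = q * p by exists (p ^+ n.-1); rewrite -exprSr prednK.
case: pn => q pnE.
exists (fun f : mor (ev e : hmf W) (ev e) =>
  exists2 r, rdvd p r & represents f (ev_map r r)); split.
- by exists 0 => //; apply: ev_represents0.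
- move=> f g [r [x rE] fE] [s [y sE] gE]; exists (r + s).
    by exists (x + y); rewrite mulrDl rE sE.
  by rewrite -ev_mapD; apply: representsD.
- move=> g f [r [x rE] fE].
  have [s [s' [gE h1 _]]] := ev_represents_surj g.
  have ss' : s' = s.
    by move: h1; rewrite mulrC; apply: mulIf; rewrite expf_neq0.
  rewrite ss' in gE; exists (s * r).
    by exists (s * x); rewrite -mulrA rE.
  by have := represents_comp gE fE; rewrite ev_map_comp.
- case=> r [x rE] idE.
  have [+ _] := ev_represents_eqP (ev_represents_id e) idE.
  case=> // h0 [h1 [h _]]; move/negP: pU; apply.
  apply/unitrPr; exists (q * h1 + h0 * c + x).
  move: h; rewrite pnE uE rE => h.
  by rewrite -[RHS](subrK (x * p)) h; ring.
- move=> f nIf.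
  have [r [r' [fE h1 _]]] := ev_represents_surj f.
  have rr' : r' = r.
    by move: h1; rewrite mulrC; apply: mulIf; rewrite expf_neq0.
  rewrite rr' in fE.
  have [s [t st]] : comaximal (p ^+ n) r.
    apply/comaximalC/comaximalX/comaximalC; apply: prime_comaximal => // pr.
    by apply: nIf; exists r.
  have [y yE] : exists y : mor (ev e : hmf W) (ev e), represents y (ev_map t t).
    by apply: ev_represents_ex; ring.
  exists y; have := represents_comp yE fE; rewrite ev_map_comp => h.
  apply/(ev_represents_eqP h (ev_represents_id e)).
  by exists 0, (- s); rewrite -st; split; ring.
Qed.

(** If [p] did not divide the cofactor [u], then [p ^ n] and [u] would be
    comaximal and the object zero. *)
Lemma primary_local (a : hmf W) : bezout_domain R ->
  primary_factorization a -> ~ zero_object a -> local_endo a.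
Proof.
move=> bezR [v u e [p [n [pp n0 vE]]]]; subst v => nz.
apply: ev_prime_power_local => //.
have [//|npu] := EM (rdvd p u); case: nz; apply: ev_zero.
by apply/comaximalC/comaximalX/comaximalC/prime_comaximal.
Qed.

Lemma rank1_iso (M : vectType R) : dim M = 1%N ->
  exists (f : 'Hom(M, R^o)) (g : 'Hom((R^o : vectType R), M)),
    (f \o g = \1)%VF /\ (g \o f = \1)%VF.
Proof.
move=> dM; pose i0 : 'I_(dim M) := cast_ord (esym dM) ord0.
have ordE (i : 'I_(dim M)) : i = i0.
  by apply: val_inj; have := ltn_ord i; rewrite {2}dM /=; case: (val i).
pose m : M := r2v (const_mx 1).
have [f fE] : exists f : 'Hom(M, R^o), forall x, f x = v2r x 0 i0.
  have flin : linear (fun x : M => v2r x 0 i0 : R^o).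
    by move=> k x y; rewrite linearP !mxE.
  pose L := GRing.isLinear.Build R M R^o _ _ flin.
  pose F : {linear M -> R^o} := HB.pack (fun x : M => v2r x 0 i0 : R^o) L.
  by exists (linfun F) => x; rewrite lfunE.
have [g gE] : exists g : 'Hom((R^o : vectType R), M), forall x, g x = x *: m.
  have glin : linear (fun x : R^o => x *: m : M).
    by move=> k x y; rewrite scalerDl scalerA.
  pose L := GRing.isLinear.Build R R^o M _ _ glin.
  pose F : {linear R^o -> M} := HB.pack (fun x : R^o => x *: m : M) L.
  by exists (linfun F) => x; rewrite lfunE.
exists f, g; split; apply/lfunP => x; rewrite comp_lfunE id_lfunE fE gE.
  by rewrite linearZ /= r2vK !mxE mulr1.
apply: (can_inj v2rK); rewrite linearZ /= r2vK; apply/rowP => i.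
by rewrite !mxE mulr1 (ordE i).
Qed.

(** A choice of generators of the two rank one modules turns the odd
    differential into two scalars. *)
Lemma elementary_iso_ev (a : hmf W) : elementary_factorization a ->
  exists v u (e : v * u = W), isomorphic (ev e : hmf W) a.
Proof.
case=> /rank1_iso [f0 [g0 [fg0 gf0]]] /rank1_iso [f1 [g1 [fg1 gf1]]].
have [D0 [D1 DE]] := odd_blocks (mf_D_odd (m := a)).
have [v vE] := endo_sc (f0 \o D0 \o g1)%VF.
have [u uE] := endo_sc (f1 \o D1 \o g0)%VF.
have e : v * u = W.
  apply: sc_inj; rewrite -scM -vE -uE.
  have := mf_D_sq a; rewrite DE odd_odd -even_map1 even_mapZ.
  case/even_map_inj=> DD _.
  rewrite -!comp_lfunA (comp_lfunA g1) gf1 comp_lfun1l (comp_lfunA D0) DD.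
  by rewrite -comp_lfunZl comp_lfun1l -comp_lfunZr fg0.
exists v, u, e.
have [f fE] : exists f : mor (ev e : hmf W) a, represents f (even_map g0 g1).
  apply: represents_ex; first exact: even_map_homogeneous.
  rewrite /= ev_DE DE odd_even even_odd -vE -uE; congr odd_map.
    by rewrite !comp_lfunA gf0 comp_lfun1l.
  by rewrite !comp_lfunA gf1 comp_lfun1l.
have [g gE] : exists g : mor a (ev e : hmf W), represents g (even_map f0 f1).
  apply: represents_ex; first exact: even_map_homogeneous.
  rewrite /= ev_DE DE odd_even even_odd -vE -uE; congr odd_map.
    by rewrite -!comp_lfunA gf1 comp_lfun1r.
  by rewrite -!comp_lfunA gf0 comp_lfun1r.
exists f, g; split.
  have := represents_comp gE fE; rewrite even_even fg0 fg1 even_map1 => h.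
  exact: represents_inj h (represents_id _).
have := represents_comp fE gE; rewrite even_even gf0 gf1 even_map1 => h.
exact: represents_inj h (represents_id _).
Qed.
End ElementaryObjects.

(** * Decomposition into primary factorizations *)

Section Decomposition.
Variables (R : idomainType) (W : R).
Hypothesis bezR : bezout_domain R.

Definition nonzero_primary (a : hmf W) : Prop :=
  primary_factorization a /\ ~ zero_object a.

(** The exponent [n = 0] is allowed, and then the object is zero; this happens
    for the primes that do not divide [v] in [ev_decomposes]. *)
Lemma prime_power_decomposes p n u (e : p ^+ n * u = W) :
  prime_elt p -> decomposes nonzero_primary (ev e : hmf W).
Proof.
move=> pp; have [|nz] := EM (zero_object (ev e : hmf W)).
  exact: decomposes_zero.
apply: decomposes_single; split=> //; split; exists p, n; split=> //.
rewrite lt0n; apply/eqP => n0; case: nz; apply: ev_zero.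
by rewrite n0 expr0; apply/comaximalC/comaximal1.
Qed.

(** The primes of [W_c] are stripped from [v] one at a time.  What remains of [v]
    after the primes outside [r] have been removed divides [W_0] times the powers
    of the primes in [r], hence is comaximal with the removed powers; when [r] is
    empty, a common divisor of [v] and [u] is a critical divisor of [W_0] unless
    it is a unit. *)
Lemma ev_decomposes (W0 : R) (N : nat) (p : 'I_N -> R) (n : 'I_N -> nat) :
  let Wc := \prod_i p i ^+ n i in
  W != 0 -> W = W0 * Wc -> (forall i, prime_elt (p i) /\ (2 <= n i)%N) ->
  (forall i j, i != j -> ~ associated (p i) (p j)) ->
  (forall d, ~ critical_divisor W0 d) -> rcoprime W0 Wc ->
  forall v u (e : v * u = W), decomposes nonzero_primary (ev e : hmf W).
Proof.
move=> Wc Wnz WE pP npp W0c W0Wc.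
have cWc : comaximal W0 Wc by apply: rcoprime_comaximal.
have cW0p i : comaximal W0 (p i).
  apply: comaximal_dvdr cWc; rewrite /Wc (bigD1 i) //=.
  exists (p i ^+ (n i).-1 * \prod_(j | j != i) p j ^+ n j).
  by rewrite mulrAC -exprSr prednK //; case: (pP i) => _ /ltnW.
have cpp i j : i != j -> comaximal (p i) (p j).
  move=> ij; have [ppi _] := pP i; have [ppj _] := pP j.
  by apply: prime_nassoc_comaximal => //; apply: npp.
suff strip : forall r : seq 'I_N, uniq r -> forall v u c (e : v * u = W),
    v * c = W0 * \prod_(i <- r) p i ^+ n i ->
    decomposes nonzero_primary (ev e : hmf W).
  by move=> v u e; apply: (strip (index_enum _) (index_enum_uniq _) v u u);
    rewrite e WE.
elim=> [_|i r IH /= /andP[ir /IH {}IH]] v u c e.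
  rewrite big_nil mulr1 => vc; apply/decomposes_zero/ev_zero.
  apply: rcoprime_comaximal => // d [a vE] [b uE].
  have [//|dU] := boolP (d \is a GRing.unit).
  have v0 : v != 0 by apply: contraNneq Wnz => v0; rewrite -e v0 mul0r.
  (* From [v u = W = W_0 W_c = v c W_c]. *)
  have uE' : u = c * Wc by apply: (mulfI v0); rewrite e WE mulrA vc.
  have dW0 : rdvd d W0 by exists (c * a); rewrite -vc vE; ring.
  have [b' cE] : rdvd d c.
    apply: (comaximal_dvd_mul (y := Wc)); first exact: comaximal_dvdl cWc.
    by exists b; rewrite mulrC -uE'.
  by case: (W0c d); split=> //; exists (a * b'); rewrite -vc vE cE; ring.
rewrite big_cons mulrCA => vc.
have [ppi _] := pP i.
have [k [v' [c' [vE vc']]]] := split_prime_power ppi vc; subst v.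
have ca : comaximal (p i ^+ k) v'.
  apply/comaximalC/comaximalX/comaximalC.
  apply: comaximal_dvdr (_ : comaximal _ (W0 * \prod_(i <- r) p i ^+ n i)).
    by exists c'; rewrite -vc' mulrC.
  apply: comaximalM; first exact/comaximalC.
  apply: comaximal_prod => j jr; apply: comaximalX; apply: cpp.
  by apply: contraNneq ir => ->.
have ea : p i ^+ k * (v' * u) = W by rewrite mulrA.
have eb : v' * (p i ^+ k * u) = W by rewrite mulrCA.
apply: decomposes_sum (ev_split e ea eb ca) => -[].
  exact: prime_power_decomposes.
exact: IH vc'.
Qed.

End Decomposition.

(** * The category of sums of elementary factorizations *)

Section BoldHef.
Variables (R : idomainType) (W : R).
Hypotheses (bezR : bezout_domain R) (critW : critically_finite W).

Lemma elementary_decomposes (a : hmf W) :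
  elementary_factorization a -> decomposes (@nonzero_primary R W) a.
Proof.
case/elementary_iso_ev=> v [u [e va]]; apply: decomposes_iso va _.
have [Wnz _ [W0 [N [p [n [WE pP npp [_ W0c] W0Wc]]]]]] := critW.
exact: ev_decomposes Wnz WE pP npp W0c W0Wc v u e.
Qed.

Lemma bold_hef_decomposes_hmf (a : hmf W) :
  in_bold_hef a -> decomposes (@nonzero_primary R W) a.
Proof.
elim=> {a} [a|n F X _ PF FX]; first exact: elementary_decomposes.
exact: decomposes_sum PF FX.
Qed.

Lemma primary_elementary (a : hmf W) :
  primary_factorization a -> elementary_factorization a.
Proof. by case=> v u e _; split. Qed.

(** Morphisms and identities of the full subcategory are those of [hmf W], so
    that summands and vanishing carry over. *)
Lemma bold_hef_decomposes (X : bold_hef W) :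
  decomposes (fun Y : bold_hef W =>
    primary_factorization (sval Y) /\ ~ zero_object Y) X.
Proof.
have [I [F [PF FX]]] := bold_hef_decomposes_hmf (svalP X).
pose F' i : bold_hef W := exist _ (F i)
  (BoldHefElementary (primary_elementary (PF i).1)).
exists I, F'; split; last exact: FX.
move=> i; split; first by case: (PF i).
by move=> /zero_objectP F0; case: (PF i) => _ []; apply/zero_objectP.
Qed.

Lemma bold_hef_sums (I : finType) (F : I -> bold_hef W) :
  exists X, direct_sum F X.
Proof.
have Z0 : exists Z : hmf W, zero_object Z.
  by exists (ev (mul1r W)); apply: ev_zero; apply/comaximalC/comaximal1.
have sum2 (a b : hmf W) :
    exists c : hmf W, direct_sum (fun x : bool => if x then a else b) c.
  by exists (mf_sum a b); apply: mf_sum_direct.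
have [X FX] := finite_direct_sums Z0 sum2 (fun i => sval (F i)).
have boldX : in_bold_hef X.
  apply: BoldHefSum (direct_sum_reindex (@enum_val_bij I) FX) => i.
  exact: svalP.
by exists (exist _ X boldX).
Qed.

Lemma bold_hef_primary_local (X : bold_hef W) :
  primary_factorization (sval X) -> ~ zero_object X -> local_endo X.
Proof.
move=> PX nz; apply: (primary_local bezR PX) => /zero_objectP X0.
by case: nz; apply/zero_objectP.
Qed.

End BoldHef.

Theorem theorem3p2 (R : idomainType) (W : R)
    (bezR : bezout_domain R) (critW : critically_finite W) :
  [/\ krull_schmidt (bold_hef W),
      forall X : bold_hef W,
        ~ zero_object X /\ indecomposable X <->
        exists Y : bold_hef W,
          [/\ primary_factorization (sval Y), ~ zero_object Y & isomorphic X Y]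
    & additively_generated
        (fun X : bold_hef W => primary_factorization (sval X))].
Proof.
split.
- split=> [n F|X]; first exact: bold_hef_sums.
  have [n [F [PF FX]]] := decomposes_ord (bold_hef_decomposes bezR critW X).
  exists n, F; split=> // i; apply: local_endo_quasi_local.
  by case: (PF i); apply: bold_hef_primary_local.
- move=> X; split=> [[nz indX]|[Y [PY Ynz XY]]].
    have [? [] //|Y [[PY Ynz] XY]] :=
      indecomposable_decomposes (@bold_hef_sums R W) _
        (bold_hef_decomposes bezR critW X) nz indX.
    by exists Y.
  have Yl := bold_hef_primary_local bezR PY Ynz.
  split; first by move/(zero_object_iso XY).
  exact: indecomposable_iso (isomorphic_sym XY) (local_endo_indecomposable Yl).
- move=> X; have [n [F [PF FX]]] :=
    decomposes_ord (bold_hef_decomposes bezR critW X).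
  by exists n, F; split=> // i; case: (PF i).
Qed.
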